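(* Let $a,b,n$ be positive integers with $n$ even and $\sum_{i=1}^{n}b^i<a$. Put $\omega_i=a+b^i$ for $1\le i\le n$ and $K=a\cdot n/2$. Then the Pseudo-Boolean constraint $\omega_1x_1+\dots+\omega_nx_n\le K$ is equivalent (as a Boolean function of $x_1,\dots,x_n\in\{0,1\}$) to the cardinality constraint $x_1+\dots+x_n\le n/2-1$. Consequently, for every variable ordering, the ROBDD of $\omega_1x_1+\dots+\omega_nx_n\le K$ has size $\mathcal{O}(n^2)$ (with an absolute implied constant).
   Context: A Pseudo-Boolean constraint is viewed as the Boolean function with value 1 exactly on the assignments satisfying the inequality. For a fixed ordering of the variables, the ROBDD (reduced ordered binary decision diagram) of a Boolean function is its unique ordered BDD in which no node has two identical children and no two distinct nodes root isomorphic subdiagrams. The size of a BDD is its number of nodes. *)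

(* Defs.v *)
From mathcomp Require Import all_boot all_order all_fingroup.

Set Implicit Arguments.
Unset Strict Implicit.
Unset Printing Implicit Defensive.

Notation assignment n := {ffun 'I_n -> bool}.

(* The coefficients are natural numbers, which covers all constraints with    *)
(* nonnegative coefficients; booleans are coerced to {0, 1}.                  *)
Definition pb_constraint n (w : 'I_n -> nat) (K : nat) (x : assignment n)
  : bool := \sum_(i < n) w i * x i <= K.

Definition card_constraint n (K : nat) (x : assignment n) : bool :=
  \sum_(i < n) x i <= K.

Inductive bdd_content (n : nat) (V : Type) : Type :=
| Terminal of bool
| Decision of 'I_n & V & V. (* variable, child if false, child if true *)

Arguments Terminal {n V}.

Definition map_content n V W (f : V -> W) (c : bdd_content n V)
  : bdd_content n W :=
  match c with
  | Terminal b => Terminal b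
  | Decision i lo hi => Decision i (f lo) (f hi)
  end.

(* A labelled, possibly cyclic graph with a distinguished node; acyclicity    *)
(* and reachability of all nodes are part of bdd_ordered and bdd_rooted.      *)
Record bdd (n : nat) : Type := Bdd {
  node : finType;
  root : node;
  content : node -> bdd_content n node
}.

Arguments root {n} b.
Arguments content {n} b.

Definition bdd_size n (B : bdd n) : nat := #|node B|.

Definition edge n (B : bdd n) : rel (node B) := fun u v =>
  if content B u is Decision _ lo hi then (v == lo) || (v == hi) else false.

Definition reach n (B : bdd n) (u : node B) : {set node B} :=
  [set v | connect (@edge n B) u v].

Inductive evals n (B : bdd n) (x : assignment n) : node B -> bool -> Prop :=
| EvalTerminal u b : content B u = Terminal b -> evals x u b
| EvalDecision u i lo hi b : content B u = Decision i lo hi ->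
    evals x (if x i then hi else lo) b -> evals x u b.

Definition represents n (B : bdd n) (f : assignment n -> bool) : Prop :=
  forall x, evals x (root B) (f x).

Definition bdd_rooted n (B : bdd n) : Prop := reach (root B) = [set: node B].

(* A variable ordering is a permutation s; s i is the position of variable i. *)
(* Positions strictly increase along edges, so an ordered BDD has no cycle.   *)
Definition bdd_ordered n (s : 'S_n) (B : bdd n) : Prop :=
  forall u v i lo hi j lo' hi', edge u v ->
    content B u = Decision i lo hi -> content B v = Decision j lo' hi' ->
    s i < s j.

Definition isomorphic_subdiagrams n (B : bdd n) (u v : node B) : Prop :=
  exists phi : node B -> node B,
    [/\ phi u = v,
        {in reach u &, injective phi},
        phi @: reach u = reach v
      & {in reach u, forall w,
           content B (phi w) = map_content phi (content B w)}].

Definition bdd_reduced n (B : bdd n) : Prop :=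
  (forall u i lo hi, content B u = Decision i lo hi -> lo <> hi) /\
  (forall u v : node B, isomorphic_subdiagrams u v -> u = v).

Definition is_ROBDD n (s : 'S_n) (f : assignment n -> bool) (B : bdd n)
  : Prop :=
  [/\ bdd_rooted B, bdd_ordered s B, bdd_reduced B & represents B f].

(* Main.v *)
From mathcomp Require Import all_boot all_order all_fingroup.
From mathcomp Require Import zify.
Require Import Defs.

(** Since the powers of [b] add up to less than [a], the weight of an
    assignment with [c] ones lies in [[a c, a (c + 1)[], and exceeds [a c] when
    [c > 0]; so the bound [a n / 2] is met exactly when [c < n / 2].

    In an ordered BDD, all paths from the root to a node branch on variables
    preceding that node, so its function depends on the path only through the
    number of ones chosen along it: the function of a node is determined by its
    level and such a number, at most [(n + 1)^2] possibilities. In a reduced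
    ordered BDD distinct nodes have distinct functions, which bounds the size.

    For existence, take Boolean functions as nodes, let each of them branch on
    its first essential variable, and keep what is reachable from
    the given function. *)

Set Implicit Arguments.
Unset Strict Implicit.
Unset Printing Implicit Defensive.

(** * Single-variable updates of assignments *)

Section Assignments.

Variable n : nat.
Implicit Types (x y : assignment n) (i j : 'I_n) (b c : bool).

Definition assign x i b : assignment n := [ffun j => if j == i then b else x j].

Lemma assign_id x i : assign x i (x i) = x.
Proof. by apply/ffunP=> j; rewrite ffunE; case: eqP => [->|]. Qed.

Lemma assign_assign x i b c : assign (assign x i b) i c = assign x i c.
Proof. by apply/ffunP=> j; rewrite !ffunE; case: eqP. Qed.

Lemma assignC x i j b c :
  i != j -> assign (assign x i b) j c = assign (assign x j c) i b.
Proof.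
move=> /negbTE ij; apply/ffunP=> k; rewrite !ffunE.
by case: (k =P j) => // ->; rewrite eq_sym ij.
Qed.

End Assignments.

(** * Ordered BDDs and canonicity of the reduced ones *)

Section OrderedBDD.

Variables (n : nat) (s : 'S_n) (B : bdd n).
Implicit Types (u v w : node B) (x y : assignment n).

(** Terminals get level [n], past every position, so that levels can increase strictly along all
    edges. *)
Definition level u : nat :=
  if content B u is Decision i _ _ then s i else n.

Lemma level_le u : level u <= n.
Proof. by rewrite /level; case: (content B u) => // i _ _; apply: ltnW. Qed.

Lemma evals_inj x u b c : evals x u b -> evals x u c -> b = c.
Proof.
move=> ev; elim: ev c => {u b} [u b Eu | u i lo hi b Eu _ IH] c ev.
  by inversion ev as [? ? Eu' | ? ? ? ? ? Eu']; subst; move: Eu'; rewrite Eu => -[].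
inversion ev as [? ? Eu' | ? ? ? ? ? Eu' ev']; subst; move: Eu'; rewrite Eu //.
by case=> ? ? ?; subst; apply: IH.
Qed.

Lemma evals_child x u i lo hi b :
  content B u = Decision i lo hi -> evals x u b ->
  evals x (if x i then hi else lo) b.
Proof.
move=> Eu ev; inversion ev as [? ? Eu' | ? ? ? ? ? Eu' ev']; subst.
  by move: Eu'; rewrite Eu.
by move: Eu'; rewrite Eu => -[? ? ?]; subst.
Qed.

Lemma edge_child u i lo hi (b : bool) :
  content B u = Decision i lo hi -> edge u (if b then hi else lo).
Proof. by rewrite /edge => ->; case: b; rewrite eqxx ?orbT. Qed.

Hypothesis ordB : bdd_ordered s B.

Lemma level_edge u v : edge u v -> level u < level v.
Proof.
move=> uv; move: (uv); rewrite /edge /level.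
case Eu: (content B u) => [|i lo hi] // _.
by case Ev: (content B v) => [|j lo' hi'] //; apply: (ordB uv Eu Ev).
Qed.

Lemma level_connect u v : connect (@edge n B) u v -> level u <= level v.
Proof.
case/connectP=> p + ->; elim: p u => //= w p IH u /andP[/level_edge uw /IH].
exact/leq_trans/ltnW.
Qed.

Lemma connect_edge u v w :
  connect (@edge n B) u v -> edge v w -> level u < level w.
Proof. by move=> /level_connect uv /level_edge; apply: leq_ltn_trans. Qed.

Lemma ordered_ind (P : node B -> Prop) :
  (forall u, (forall v, edge u v -> P v) -> P u) -> forall u, P u.
Proof.
move=> IH u; have [k] := ubnP (n - level u); elim: k u => // k IHk u lek.
apply: IH => v /level_edge uv; apply: IHk.
by have := level_le v; lia.
Qed.

(** Levels increase along edges, so evaluation from [u] reads only variables at positions from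
    [level u] on. *)
Lemma evals_agree x y u b :
  (forall i, level u <= s i -> x i = y i) -> evals x u b -> evals y u b.
Proof.
move=> + ev; elim: ev => {u b} [u b Eu _ | u i lo hi b Eu _ IH agree].
  exact: EvalTerminal.
have Exy : x i = y i by apply: agree; rewrite /level Eu.
apply: (EvalDecision Eu); rewrite -Exy; apply: IH => j lej; apply: agree.
exact: leq_trans (ltnW (level_edge (edge_child (x i) Eu))) lej.
Qed.

Lemma evals_assign x u i b c :
  s i < level u -> evals (assign x i b) u c -> evals x u c.
Proof.
move=> lti; apply: evals_agree => j lej; rewrite ffunE.
by case: eqP lej lti => // ->; lia.
Qed.

(** The child lies strictly past the position of [i], so [x i] may be set to [b], which selects this
    child, without changing the value there. *)
Lemma evals_cofactor (h : assignment n -> bool) u i lo hi b :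
  content B u = Decision i lo hi -> (forall x, evals x u (h x)) ->
  forall x, evals x (if b then hi else lo) (h (assign x i b)).
Proof.
move=> Eu ev x; have := evals_child Eu (ev (assign x i b)).
rewrite ffunE eqxx; apply: evals_assign.
by have := level_edge (edge_child b Eu); rewrite {1}/level Eu.
Qed.

(** A nonempty path would leave [u] by an edge that is also an edge of [v], closing a cycle through
    [v]. *)
Lemma content_connect u v :
  content B u = content B v -> connect (@edge n B) u v -> u = v.
Proof.
move=> Euv /connectP[[//|w p] /= /andP[uw pth] Ev].
have wv : connect (@edge n B) w v by apply/connectP; exists p.
have vw : edge v w by move: uw; rewrite /edge Euv.
by have := connect_edge wv vw; rewrite ltnn.
Qed.

(* Redirecting [u] to [v] and fixing all other nodes is an isomorphism. *)
Lemma content_isomorphic u v :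
  content B u = content B v -> isomorphic_subdiagrams u v.
Proof.
move=> Euv; pose phi w := if w == u then v else w.
have phiE w t : connect (@edge n B) u w -> edge w t -> phi t = t.
  move=> uw wt; rewrite /phi; case: eqP => // tu.
  by have := connect_edge uw wt; rewrite tu ltnn.
have edgeuv t : edge u t = edge v t by rewrite /edge Euv.
exists phi; split.
- by rewrite /phi eqxx.
- move=> w t; rewrite !inE /phi => uw ut.
  case: eqP => [-> | _]; case: eqP => [-> | _] // E.
    by apply: content_connect; rewrite // -E.
  by symmetry; apply: content_connect; rewrite // E.
- apply/setP=> t; rewrite !inE; apply/imsetP/idP => [[w]|].
    rewrite inE => + ->; rewrite /phi; case: eqP => [_ _ | neq uw].
      exact: connect0.
    case/connectP: uw neq => [[|z p] /= pth -> //]; case/andP: pth => uz pth _.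
    apply: connect_trans (connect1 _) _; first by rewrite -edgeuv; apply: uz.
    by apply/connectP; exists p.
  case/connectP=> [[|z p] /= pth ->].
    by exists u; rewrite ?inE ?connect0 // /phi eqxx.
  case/andP: pth => vz pth; have zl : connect (@edge n B) z (last z p).
    by apply/connectP; exists p.
  have uz : edge u z by rewrite edgeuv.
  exists (last z p); first by rewrite inE (connect_trans (connect1 uz)).
  rewrite /phi; case: eqP => // lu.
  by have := connect_edge zl (_ : edge _ z); rewrite lu => /(_ uz); rewrite ltnn.
- move=> w; rewrite inE => uw.
  have -> : content B (phi w) = content B w.
    by rewrite /phi; case: eqP => [->|].
  case Ew: (content B w) => [|i lo hi] //=.
  by rewrite (phiE _ _ uw (edge_child false Ew)) (phiE _ _ uw (edge_child true Ew)).
Qed.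

Hypothesis redB : bdd_reduced B.

(** Induction on the smaller of the two levels, downwards from [n]. Nodes at the same level have
    equal contents, by induction on their children, and are therefore isomorphic. *)
Lemma reduced_evals_inj (h : assignment n -> bool) u v :
  (forall x, evals x u (h x)) -> (forall x, evals x v (h x)) -> u = v.
Proof.
have [k] := ubnP (n - minn (level u) (level v)).
elim: k h u v => // k IH h u v.
wlog leuv: u v / level u <= level v => [Hw | ltk evu evv].
  case/orP: (leq_total (level u) (level v)) => le ltk evu evv.
    exact: Hw.
  by symmetry; apply: Hw; rewrite // minnC.
have levn := level_le v.
case Eu: (content B u) => [b|i lo hi].
  case Ev: (content B v) => [c|j lo hi]; last first.
    by have := ltn_ord (s j); move: leuv; rewrite /level Eu Ev; lia.
  apply: redB.2; apply: content_isomorphic; rewrite Eu Ev; congr Terminal.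
  have -> : b = h [ffun=> false] := evals_inj (EvalTerminal _ Eu) (evu _).
  by have := evals_inj (evv _) (EvalTerminal [ffun=> false] Ev).
have lev_u : level u = s i by rewrite /level Eu.
have ltsn := ltn_ord (s i).
have ev_lo := evals_cofactor false Eu evu.
have ev_hi := evals_cofactor true Eu evu.
have lt_lo := level_edge (edge_child false Eu).
have lt_hi := level_edge (edge_child true Eu).
(* If [v] has the larger level, its function ignores [i]; both children of [u] then represent [h]
   and coincide by induction, contradicting reducedness. *)
have [ltuv | ] := ltnP (level u) (level v).
  case: (redB.1 _ _ _ _ Eu); apply: (IH h); first by rewrite /= in lt_lo lt_hi *; lia.
  - move=> x; rewrite (evals_inj (evv x) (evals_assign _ (evv (assign x i false)))) //.
    by rewrite -lev_u.
  - move=> x; rewrite (evals_inj (evv x) (evals_assign _ (evv (assign x i true)))) //.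
    by rewrite -lev_u.
move=> levu; have {leuv levu} Elev : level v = level u by lia.
case Ev: (content B v) => [c|j lo' hi'].
  by move: Elev; rewrite lev_u /level Ev; lia.
have Eji : j = i.
  by apply: (@perm_inj _ s); apply: val_inj; rewrite /= -lev_u -Elev /level Ev.
subst j; apply: redB.2; apply: content_isomorphic; rewrite Eu Ev.
have lt_lo' := level_edge (edge_child false Ev).
have lt_hi' := level_edge (edge_child true Ev).
rewrite /= in lt_lo lt_hi lt_lo' lt_hi'; congr Decision.
- by apply: (IH _ lo lo' _ ev_lo (evals_cofactor false Ev evv)); lia.
- by apply: (IH _ hi hi' _ ev_hi (evals_cofactor true Ev evv)); lia.
Qed.

End OrderedBDD.

(** * Counting the nodes for a cardinality constraint *)

Section SizeBound.

Variables (n : nat) (s : 'S_n) (K : nat).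

(** The subfunction left after fixing the variables at positions before [k], with [c] of them
    true. *)
Definition tail_constraint (k c : nat) (x : assignment n) : bool :=
  c + \sum_(i < n | k <= s i) x i <= K.

(** [c] is the number of true branches on a path from the root to [u]. Variables skipped by the path
    do not affect the value at [u]; they are set to false, to contribute nothing. *)
Lemma node_tail_constraint (B : bdd n) (u : node B) :
  bdd_rooted B -> bdd_ordered s B -> represents B (@card_constraint n K) ->
  exists2 c, c <= level s u &
    forall x, evals x u (tail_constraint (level s u) c x).
Proof.
move=> rootB ordB repB.
pose Q (w : node B) := exists2 c, c <= level s w &
  forall x, evals x w (tail_constraint (level s w) c x).
suff step v w : Q v -> connect (@edge n B) v w -> Q w.
  apply: (step (root B)); last first.
    have: u \in [set: node B] by [].
    by rewrite -rootB inE.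
  exists 0 => // x; set l := level s (root B).
  pose y : assignment n := [ffun j => (l <= s j) && x j].
  suff -> : tail_constraint l 0 x = card_constraint K y.
    by apply: (evals_agree ordB) (repB y) => j lej; rewrite ffunE lej.
  rewrite /tail_constraint /card_constraint add0n big_mkcond /=.
  by congr (_ <= _); apply: eq_bigr => j _; rewrite ffunE; case: ifP.
move=> + /connectP[p + ->]; elim: p v => //= z p IH v [c lec evv] /andP[vz].
apply: IH => {p w}; have ltvz := level_edge ordB vz.
move: (vz); rewrite /edge; case Ev: (content B v) => [|i lo hi] // zE.
have [b Ez] : exists b : bool, z = if b then hi else lo.
  by case/orP: zE => /eqP->; [exists false | exists true].
have lev_v : level s v = s i by rewrite /level Ev.
(* The edge raises the level by at least one, which makes room for [b]. *)
exists (c + b) => [|x]; first by case: b {Ez}; lia.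
(* [y] takes branch [b] at [i] and is false at all other positions before the level of [z]. *)
pose y : assignment n := assign [ffun j => (level s z <= s j) && x j] i b.
suff -> : tail_constraint (level s z) (c + b) x = tail_constraint (level s v) c y.
  have yi : y i = b by rewrite ffunE eqxx.
  have := evals_child Ev (evv y); rewrite yi -Ez; apply: (evals_agree ordB) => j lej.
  by rewrite !ffunE lej; case: eqP lej ltvz => // ->; lia.
rewrite /tail_constraint [in RHS](bigD1 i) /= ?lev_v // ffunE eqxx -addnA.
congr (_ + (_ + _) <= _); rewrite [LHS]big_mkcond [RHS]big_mkcond.
apply: eq_bigr => j _; rewrite !ffunE; case: eqP => [-> | _]; rewrite ?andbF ?andbT.
  by case: leqP => // lezi; lia.
case: leqP => //= [lezj | _]; last by rewrite if_same.
by have -> : s i <= s j by lia.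
Qed.

Lemma card_ROBDD_size (B : bdd n) :
  is_ROBDD s (@card_constraint n K) B -> bdd_size B <= n.+1 ^ 2.
Proof.
case=> rootB ordB redB repB.
have /fin_all_exists[code codeP] (u : node B) : exists kc : 'I_n.+1 * 'I_n.+1,
    forall x, evals x u (tail_constraint kc.1 kc.2 x).
  have [c lec ev] := node_tail_constraint u rootB ordB repB.
  have lev := level_le s u.
  exists (inord (level s u), inord c) => x; rewrite /= !inordK //; lia.
rewrite -mulnn -{1 2}(card_ord n.+1) -card_prod; apply: (leq_card code) => u v Euv.
apply: (reduced_evals_inj ordB redB (codeP u)); rewrite Euv; exact: codeP.
Qed.

End SizeBound.

(** * The reachable part of a BDD, and isomorphic subdiagrams *)

Section Prune.

Variables (n : nat) (B : bdd n).

Definition prune_node : finType := {u : node B | u \in reach (root B)}.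

Lemma root_reach : root B \in reach (root B).
Proof. by rewrite inE connect0. Qed.

(** Children of reachable nodes are reachable, so [insubd] only moves them into the subtype. *)
Definition prune : bdd n :=
  @Bdd n prune_node (Sub (root B) root_reach)
    (fun u => map_content (insubd u) (content B (val u))).

Lemma prune_contentE (u : node prune) :
  map_content val (content prune u) = content B (val u).
Proof.
have reachE v : edge (val u) v -> val (insubd u v) = v.
  move=> uv; apply: insubdK; rewrite inE (connect_trans _ (connect1 uv)) //.
  by have := valP u; rewrite inE.
rewrite /=; case Eu: (content B (val u)) => [|i lo hi] //=.
by rewrite (reachE _ (edge_child false Eu)) (reachE _ (edge_child true Eu)).
Qed.

Lemma prune_edge (u v : node prune) : edge u v = edge (val u) (val v).
Proof.
rewrite /edge -prune_contentE.
by case: (content prune u) => [|i lo hi] //=; rewrite !(inj_eq val_inj).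
Qed.

Lemma prune_rooted : bdd_rooted prune.
Proof.
apply/setP=> v; rewrite !inE.
suff lift p (u : node prune) :
    path (@edge n B) (val u) p -> val v = last (val u) p ->
    connect (@edge n prune) u v.
  have := valP v; rewrite inE => /connectP[p]; exact: (lift p (root prune)).
elim: p u => [|w p IH] u /= => [_ /val_inj -> | /andP[uw pth] Ev].
  exact: connect0.
have rw : w \in reach (root B).
  by have := valP u; rewrite !inE => /connect_trans; apply; apply: connect1.
apply: (connect_trans (y := Sub w rw : node prune)); first exact/connect1/etrans/uw/prune_edge.
exact: IH.
Qed.

Lemma prune_ordered s : bdd_ordered s B -> bdd_ordered s prune.
Proof.
move=> ordB u v i lo hi j lo' hi'; rewrite prune_edge => uv Eu Ev.
by apply: (ordB _ _ i (val lo) (val hi) j (val lo') (val hi') uv);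
  rewrite -prune_contentE ?Eu ?Ev.
Qed.

Lemma prune_evals x (u : node prune) b : evals x (val u) b -> evals x u b.
Proof.
move Ew: (val u) => w ev.
elim: ev u Ew => {w b} [w b Ew | w i lo hi b Ew _ IH] u uw;
  move: Ew; rewrite -uw -prune_contentE.
  by case Eu: (content prune u) => [c|//] [<-]; apply: EvalTerminal.
case Eu: (content prune u) => [//|j lo' hi'] [? Elo Ehi]; subst j.
by apply: (EvalDecision Eu); apply: IH; rewrite -Elo -Ehi; case: (x i).
Qed.

End Prune.

(** The isomorphism maps the evaluation path from [u] to one from [v] with the same branches and
    terminal. *)
Lemma isomorphic_evals n (B : bdd n) (u v : node B) x b :
  isomorphic_subdiagrams u v -> evals x u b -> evals x v b.
Proof.
case=> phi [<- _ _ phiE] evu.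
suff image w c : evals x w c -> connect (@edge n B) u w -> evals x (phi w) c.
  exact: image (connect0 _ _).
elim=> {w c evu} [w c Ew | w i lo hi c Ew _ IH] uw.
  by apply: EvalTerminal; rewrite phiE ?inE // Ew.
have Epw : content B (phi w) = Decision i (phi lo) (phi hi).
  by rewrite phiE ?inE // Ew.
apply: (EvalDecision Epw); rewrite -(fun_if phi); apply: IH.
exact/(connect_trans uw)/connect1/edge_child/Ew.
Qed.

(** * Existence of the ROBDD through cofactors *)

Section Existence.

Variables (n : nat) (s : 'S_n).

Notation boolfun := {ffun assignment n -> bool}.
Implicit Types (f g : boolfun) (i j : 'I_n).

Definition cofactor i b g : boolfun := [ffun x => g (assign x i b)].

Definition depends g i : bool := cofactor i false g != cofactor i true g.

Lemma not_depends g i x b : ~~ depends g i -> g (assign x i b) = g x.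
Proof.
move=> /negPn/eqP/ffunP/(_ x); rewrite !ffunE => E.
by rewrite -[in RHS](assign_id x i); case: b; case: (x i).
Qed.

(** Setting [i] removes the dependence on [i]; for any other variable the two updates commute. *)
Lemma depends_cofactor g i b j :
  depends (cofactor i b g) j -> (j != i) && depends g j.
Proof.
apply: contraTT; rewrite negb_and negbK => /orP[/eqP-> | ndep].
  by apply/negPn/eqP/ffunP=> x; rewrite !ffunE !assign_assign.
apply/negPn/eqP/ffunP=> x; rewrite !ffunE.
have [->|ji] := eqVneq j i; first by rewrite !assign_assign.
by rewrite !(assignC x _ _ ji) !(not_depends _ _ ndep).
Qed.

Lemma not_depends_const g x y : (forall i, ~~ depends g i) -> g x = g y.
Proof.
move=> ndep.
(* The coordinates in [r] are switched from [x] to [y] one at a time. *)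
have mix (r : seq 'I_n) : g [ffun j => if j \in r then y j else x j] = g x.
  elim: r => [|i r IH]; first by congr (g _); apply/ffunP=> j; rewrite ffunE.
  rewrite -[RHS]IH -[RHS](not_depends _ (y i) (ndep i)); congr (g _).
  by apply/ffunP=> j; rewrite !ffunE inE; case: eqP => [->|].
rewrite -(mix (enum 'I_n)); congr (g _); apply/ffunP=> j.
by rewrite ffunE mem_enum.
Qed.

Definition first_dependency g : option 'I_n :=
  [pick i | depends g i && [forall j, depends g j ==> (s i <= s j)]].

(** A function without essential variable is constant; its label is read off at the all-false
    assignment. *)
Definition cofactor_bdd f : bdd n :=
  @Bdd n boolfun f (fun g =>
    if first_dependency g is Some i
    then Decision i (cofactor i false g) (cofactor i true g)
    else Terminal (g [ffun=> false])).

Variant cofactor_spec f g : bdd_content n boolfun -> Prop :=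
  | CofactorTerminal b of (forall x, g x = b) : cofactor_spec f g (Terminal b)
  | CofactorDecision i of depends g i & (forall j, depends g j -> s i <= s j) :
      cofactor_spec f g (Decision i (cofactor i false g) (cofactor i true g)).

Lemma cofactorP f g : cofactor_spec f g (content (cofactor_bdd f) g).
Proof.
rewrite /= /first_dependency; case: pickP => [i /andP[dep /forallP mini] | none].
  by constructor=> // j; apply/implyP.
(* If any variable were essential, one of least position could have been picked. *)
constructor=> x; apply: not_depends_const => i; apply/negP=> dep.
have [j depj minj] := arg_minnP (fun j => s j : nat) dep.
have := none j; rewrite depj /= => /negbT/forallP[] k; exact/implyP/minj.
Qed.

(** A variable essential for a cofactor of [g] at [i0] is essential for [g] and differs from [i0],
    so minimality of [i0] puts it strictly later. *)
Lemma cofactor_ordered f : bdd_ordered s (cofactor_bdd f).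
Proof.
move=> g h i lo hi j lo' hi'; rewrite /edge.
case: (cofactorP f g) => // i0 _ mini gh [<- _ _].
case: (cofactorP f h) => // j0 + _ [<- _ _] => deph.
have /andP[neq dep] : (j0 != i0) && depends g j0.
  by case/orP: gh => /eqP Eh; move: deph; rewrite Eh; apply: depends_cofactor.
rewrite ltn_neqAle mini // andbT.
by apply: contraNneq neq => /val_inj/perm_inj ->.
Qed.

Lemma cofactor_evals f x (g : node (cofactor_bdd f)) : evals x g ((g : boolfun) x).
Proof.
elim/(ordered_ind (@cofactor_ordered f)): g => g IH.
case Eg: _ / (cofactorP f g) => [b gE | i _ _].
  by rewrite gE; apply: EvalTerminal.
(* Shannon expansion at [i]. *)
have -> : g x = (if x i then cofactor i true g else cofactor i false g) x.
  by rewrite -{1}(assign_id x i); case: (x i); rewrite ffunE.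
exact/(EvalDecision Eg)/IH/edge_child/Eg.
Qed.

(** Nodes are functions and represent themselves, so isomorphic nodes are equal; equal children
    would contradict the dependence on the branching variable. *)
Theorem ROBDD_exists (f : assignment n -> bool) : exists B, is_ROBDD s f B.
Proof.
pose F : boolfun := [ffun x => f x]; pose B := prune (cofactor_bdd F).
have evalsB x (u : node B) : evals x u ((val u : boolfun) x).
  exact/prune_evals/cofactor_evals.
exists B; split.
- exact: prune_rooted.
- exact/prune_ordered/cofactor_ordered.
- split=> [u i lo hi Eu lohi | u v uv].
    have := prune_contentE u; rewrite Eu lohi.
    case: (cofactorP F (val u)) => [//|j dep _ [_ Elo Ehi]].
    by move: dep; rewrite /depends -Elo -Ehi eqxx.
  apply/val_inj/ffunP=> x.
  exact: evals_inj (isomorphic_evals uv (evalsB x u)) (evalsB x v).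
- by move=> x; have := evalsB x (root B); rewrite ffunE.
Qed.

End Existence.

(** * From the Pseudo-Boolean to the cardinality constraint *)

Lemma eq_is_ROBDD n (s : 'S_n) (f g : assignment n -> bool) (B : bdd n) :
  f =1 g -> is_ROBDD s f B -> is_ROBDD s g B.
Proof. by move=> fg [? ? ? rep]; split=> // x; rewrite -fg. Qed.

Lemma pb_constraint_cardE a b n :
  0 < b -> 0 < n -> ~~ odd n -> \sum_(1 <= i < n.+1) b ^ i < a ->
  pb_constraint (fun i : 'I_n => a + b ^ i.+1) (a * n./2)
    =1 @card_constraint n (n./2 - 1).
Proof.
move=> b_gt0 n_gt0 even_n; rewrite big_add1 big_mkord => lt_a x.
rewrite /pb_constraint /card_constraint.
under eq_bigr do rewrite mulnDl.
rewrite big_split /= -big_distrr /=; set c := \sum_i _; set t := \sum_i _.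
have lt_ta : t < a.
  apply: leq_ltn_trans lt_a; apply: leq_sum => i _.
  by case: (x i); rewrite ?muln1 ?muln0.
(* Each selected power of [b] is at least 1, so [t] is positive as soon as [c] is. *)
have le_ct : c <= t.
  by apply: leq_sum => i _; case: (x i); rewrite ?muln1 // expn_gt0 b_gt0.
(* This makes the truncated [n./2 - 1] a true predecessor. *)
have n2 : 0 < n./2 by case: n n_gt0 even_n {x c t lt_a lt_ta le_ct} => [|[]].
apply/idP/idP => le; last first.
  by have: a * c.+1 <= a * n./2; [rewrite leq_mul2l; lia | lia].
rewrite leqNgt; apply/negP=> gt.
have: a * n./2 <= a * c by rewrite leq_mul2l; lia.
by lia.
Qed.

Theorem mainTheorem7 :
  exists C : nat, forall a b n : nat,
    0 < a -> 0 < b -> 0 < n -> ~~ odd n ->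
    \sum_(1 <= i < n.+1) b ^ i < a ->
    (* the index i : 'I_n, from 0 to n - 1, stands for the variable x_(i+1) *)
    let w := fun i : 'I_n => a + b ^ i.+1 in
    let K := a * n./2 in
    pb_constraint w K =1 @card_constraint n (n./2 - 1) /\
    forall s : 'S_n,
      (exists B : bdd n, is_ROBDD s (pb_constraint w K) B) /\
      (forall B : bdd n, is_ROBDD s (pb_constraint w K) B ->
         bdd_size B <= C * n ^ 2).
Proof.
(* For positive [n], [n.+1 ^ 2 <= (2 * n) ^ 2 = 4 * n ^ 2]. *)
exists 4 => a b n _ b_gt0 n_gt0 even_n lt_a w K.
have wE : pb_constraint w K =1 @card_constraint n (n./2 - 1).
  exact: pb_constraint_cardE.
split=> // s; split; first exact: ROBDD_exists.
move=> B /(eq_is_ROBDD wE)/card_ROBDD_size /leq_trans; apply.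
by rewrite -[4]/(2 ^ 2) -expnMn leq_exp2r //; lia.
Qed.
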